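(* Let $P$ be a Markov kernel on a finite state space $\mathcal{X}$ with stationary distribution $\pi$, where $\pi(y)>0$ for all $y\in\mathcal{X}$, and let $\pi_*=\min_{y\in\mathcal{X}}\pi(y)$. Then for every $x\in\mathcal{X}$ and every $n\in\mathbb{N}$, $$D\bigl(P^n(x,\cdot)\,\|\,\pi\bigr)\;\le\;\mathrm{sep}(x,n)\,\log(1/\pi_* ).$$
   Context: Separation: $\mathrm{sep}(x,n)=\max_{y\in\mathcal{X}}\Bigl(1-\frac{P^n(x,y)}{\pi(y)}\Bigr)$. Relative entropy: $D(\mu\|\nu)=\sum_{x}\mu(x)\log\bigl(\mu(x)/\nu(x)\bigr)$, with $0\log 0=0$ and natural logarithm. *)

(* Defs.v *)
From HB Require Import structures.
From mathcomp Require Import all_boot all_order all_algebra.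
From mathcomp Require Import all_classical all_reals all_analysis.

Set Implicit Arguments.
Unset Strict Implicit.
Unset Printing Implicit Defensive.

Import Order.TTheory GRing.Theory Num.Theory.
Local Open Scope ring_scope.

Definition is_distribution (R : realType) (X : finType) (mu : X -> R) : Prop :=
  (forall x, 0 <= mu x) /\ \sum_(x : X) mu x = 1.

Definition is_markov_kernel (R : realType) (X : finType) (P : X -> X -> R) : Prop :=
  forall x, is_distribution (P x).

Definition is_stationary (R : realType) (X : finType)
    (P : X -> X -> R) (pi : X -> R) : Prop :=
  is_distribution pi /\ forall y, \sum_(x : X) pi x * P x y = pi y.

Fixpoint kernel_pow (R : realType) (X : finType)
    (P : X -> X -> R) (n : nat) (x y : X) : R :=
  if n is m.+1 then \sum_(z : X) P x z * kernel_pow P m z y else (x == y)%:R.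

(* The base point x0 witnesses that X is nonempty. The fold starts at F x0,
   itself one of the values of F, so the result does not depend on x0. *)
Definition fin_max (R : realType) (X : finType) (x0 : X) (F : X -> R) : R :=
  \big[Num.max/F x0]_(y : X) F y.

Definition fin_min (R : realType) (X : finType) (x0 : X) (F : X -> R) : R :=
  \big[Num.min/F x0]_(y : X) F y.

Lemma fin_maxP (R : realType) (X : finType) (x0 : X) (F : X -> R) :
  (exists y, fin_max x0 F = F y) /\ (forall y, F y <= fin_max x0 F).
Proof.
split; last by move=> y; exact: le_bigmax.
rewrite /fin_max; elim/big_ind: _ => [|a b [y ->] [z ->]|y _].
- by exists x0.
- by case: (leP (F y) (F z)) => _; [exists z | exists y].
- by exists y.
Qed.

Lemma fin_minP (R : realType) (X : finType) (x0 : X) (F : X -> R) :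
  (exists y, fin_min x0 F = F y) /\ (forall y, fin_min x0 F <= F y).
Proof.
split; last by move=> y; exact: bigmin_le.
rewrite /fin_min; elim/big_ind: _ => [|a b [y ->] [z ->]|y _].
- by exists x0.
- by case: (leP (F y) (F z)) => _; [exists y | exists z].
- by exists y.
Qed.

Definition separation (R : realType) (X : finType)
    (P : X -> X -> R) (pi : X -> R) (x : X) (n : nat) : R :=
  fin_max x (fun y => 1 - kernel_pow P n x y / pi y).

(* A term with mu x = 0 vanishes whatever the value of ln, so 0 log 0 = 0.
   Since division and ln are total, this is the relative entropy only when
   nu x = 0 implies mu x = 0; the true value is +oo otherwise. *)
Definition relative_entropy (R : realType) (X : finType) (mu nu : X -> R) : R :=
  \sum_(x : X) mu x * ln (mu x / nu x).

(* Main.v *)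
Require Import Defs.
From mathcomp Require Import all_boot all_order all_algebra.
From mathcomp Require Import all_classical all_reals all_analysis.
From mathcomp Require Import ring lra.

(** With s the separation, P^n(x,.) = (1 - s) pi + s nu for some distribution
    nu. Convexity of D(. || pi) gives D(P^n(x,.) || pi) <= s D(nu || pi), and
    D(nu || pi) <= log (1 / pi_* ) since nu / pi <= 1 / pi_*. Both steps are
    carried out together and pointwise, through ln t <= t - 1. *)

Import Order.TTheory GRing.Theory Num.Theory.
Local Open Scope ring_scope.

Lemma kernel_pow_distribution (R : realType) (X : finType) (P : X -> X -> R) :
  is_markov_kernel P -> forall n x, is_distribution (kernel_pow P n x).
Proof.
move=> hP; elim=> [|n IHn] x; split=> /=.
- by move=> y; rewrite ler0n.
- rewrite (bigD1 x) //= eqxx big1 ?addr0 // => y /negbTE.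
  by rewrite eq_sym => ->.
- move=> y; apply: sumr_ge0 => z _.
  by apply: mulr_ge0; [exact: (hP x).1 | exact: (IHn z).1].
- rewrite exchange_big /= -[RHS](hP x).2; apply: eq_bigr => z _.
  by rewrite -mulr_sumr (IHn z).2 mulr1.
Qed.

Lemma distribution_le1 (R : realType) (X : finType) (mu : X -> R) (x : X) :
  is_distribution mu -> mu x <= 1.
Proof.
move=> [mu0 <-]; rewrite (bigD1 x) //= lerDl.
by apply: sumr_ge0 => y _; exact: mu0.
Qed.

Lemma ln_leB1 (R : realType) (t : R) : 0 < t -> ln t <= t - 1.
Proof.
by move=> t0; rewrite -{1}[t](subrKC 1); apply: le_ln1Dx; lra.
Qed.

(* The log-sum inequality for r = (1 - s) + b against the weights 1 - s and s,
   combined with b / s <= M. *)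
Lemma mul_ln_le_mixture {R : realType} {r s M : R} :
  0 <= r -> 0 <= 1 - s <= r -> 1 <= M -> r - (1 - s) <= s * M ->
  r * ln r <= (r - (1 - s)) * ln M.
Proof.
move=> r0 /andP[a0 ar] M1 bM.
have b0 : 0 <= r - (1 - s) by lra.
have M0 : 0 < M by lra.
(* The bound on [ln] needs a positive argument; at [r = 0] the left side vanishes and [1 <= M] makes
   the right side nonnegative. *)
have [rE|rn0] := eqVneq r 0.
  by rewrite {1}rE mul0r; apply: mulr_ge0 => //; exact: ln_ge0.
have {rn0} r0 : 0 < r by rewrite lt_def rn0.
(* Split [r] as [(1 - s) + b] and use [ln t <= t - 1] at [t = r] with weight [1 - s], at [t = r / M]
   with weight [b]. Once [b <= s * M] replaces [b * (r / M)] by [s * r], the upper bounds add up to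
   exactly 0. *)
have h1 : (1 - s) * ln r <= (1 - s) * (r - 1).
  by apply: ler_wpM2l => //; exact: ln_leB1.
have h2 : (r - (1 - s)) * (ln r - ln M) <= (r - (1 - s)) * (r / M - 1).
  apply: ler_wpM2l => //; rewrite -ln_div ?posrE //.
  by apply: ln_leB1; exact: divr_gt0.
have h3 : (r - (1 - s)) * (r / M) <= s * r.
  by rewrite mulrA ler_pdivrMr // mulrAC ler_wpM2r // ltW.
lra.
Qed.

(** The residual [mu - (1 - s) * nu] is nonnegative with total mass [s]; it plays the part of [s]
    times a distribution. Never dividing by [s] avoids a separate case [s = 0]. *)
Lemma relative_entropy_le_mixture {R : realType} {X : finType}
    {mu nu : X -> R} {s m : R} :
  is_distribution mu -> is_distribution nu -> (forall y, 0 < nu y) ->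
  0 <= 1 - s -> (forall y, 1 - s <= mu y / nu y) ->
  0 < m <= 1 -> (forall y, m <= nu y) ->
  relative_entropy mu nu <= s * ln (1 / m).
Proof.
move=> [mu0 mu1] [_ nu1] nu0 s1 smu /andP[m0 m1] mnu.
have res0 y : 0 <= mu y - (1 - s) * nu y.
  by rewrite subr_ge0 -ler_pdivlMr.
have sum_res : \sum_y (mu y - (1 - s) * nu y) = s.
  by rewrite sumrB -mulr_sumr mu1 nu1; ring.
have res_le y : mu y - (1 - s) * nu y <= s.
  rewrite -[leRHS]sum_res (bigD1 y) //= lerDl.
  by apply: sumr_ge0 => z _.
(* Expanding [s] as the sum of the residuals reduces the claim to one inequality per point; dividing
   it by [nu y] leaves the scalar lemma at [r = mu y / nu y], [M = 1 / m]. *)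
rewrite -[X in X * ln _]sum_res mulr_suml; apply: ler_sum => y _.
have nuN0 : nu y != 0 by rewrite gt_eqF.
have s0 : 0 <= s by apply: le_trans (res0 y) (res_le y).
have resE : mu y / nu y - (1 - s) = (mu y - (1 - s) * nu y) / nu y by field.
have muE : mu y = nu y * (mu y / nu y) by field.
have -> : mu y - (1 - s) * nu y = nu y * (mu y / nu y - (1 - s)) by field.
rewrite {1}muE -![nu y * _ * _]mulrA; apply: ler_wpM2l; first exact: ltW.
apply: mul_ln_le_mixture.
- by apply: divr_ge0; [exact: mu0 | exact: ltW].
- by rewrite s1 smu.
- by rewrite ler_pdivlMr // mul1r.
- rewrite resE mul1r; apply: (@le_trans _ _ (s / nu y)).
    by rewrite ler_pM2r ?invr_gt0.
  by rewrite ler_wpM2l // lef_pV2 ?posrE.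
Qed.

Theorem proposition9 (R : realType) (X : finType)
    (P : X -> X -> R) (pi : X -> R)
    (hP : is_markov_kernel P)
    (hpi : is_stationary P pi)
    (hpos : forall y : X, 0 < pi y)
    (x : X) (n : nat) :
  relative_entropy (kernel_pow P n x) pi
    <= separation P pi x n * ln (1 / fin_min x pi).
Proof.
have hmu := kernel_pow_distribution _ _ _ hP n x.
have [[y sepE] le_sep] := fin_maxP x (fun y => 1 - kernel_pow P n x y / pi y).
have [[z minE] min_le] := fin_minP x pi.
apply: (relative_entropy_le_mixture hmu hpi.1 hpos) => //.
(* At a maximizing [y], one minus the separation is the ratio [P^n(x,y) / pi y], hence
   nonnegative. *)
- rewrite /separation sepE subKr.
  by apply: divr_ge0; [exact: hmu.1 | exact: ltW].
- by move=> w; have := le_sep w; rewrite /separation /=; lra.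
- by rewrite minE hpos distribution_le1 //; exact: hpi.1.
Qed.
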